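(* Let $c\in\mathbb{R}$, let $N_0:\mathbb{R}\to\mathbb{R}$ be a differentiable function, and define functions of one real variable $s$ by $$M_{-2}(s)=-(s^3+s^2)^2,\qquad M_{-1}(s)=2(s^3+s^2)\big((3-c)(s^2+s)-N_0(s)\big).$$ Assume that $$N_1(s)=-\frac{M_{-1}'(s)+s^2(cs+c-1)^2+N_0(s)^2}{2(s^3+s^2)}$$ defines a differentiable function $N_1:\mathbb{R}\to\mathbb{R}$, in the sense that there is a differentiable $N_1:\mathbb{R}\to\mathbb{R}$ with $-2(s^3+s^2)N_1(s)=M_{-1}'(s)+s^2(cs+c-1)^2+N_0(s)^2$ for all $s\in\mathbb{R}$. Define further $$M_1(s)=-\int_0^s N_1(u)^2\,du-s,\qquad M_0(s)=\int_0^s\big(M_1(u)-2N_0(u)N_1(u)\big)\,du,$$ and let $$q=\sum_{i=-2}^{1} f^iM_i(h).$$ Then $$J(p,q)=\left(\frac{h^3+h^2}{f}-h+c(h^2+h)\right)^2+\left(\frac{h^3+h^2}{f}+N_0(h)+N_1(h)f\right)^2+f^2 .$$ Moreover, if $K\in\mathbb{R}[s]$ is any polynomial and $N_0(s)=-s+(s^2+s)K(s)$, then there is a differentiable $N_1:\mathbb{R}\to\mathbb{R}$ with $-2(s^3+s^2)N_1(s)=M_{-1}'(s)+s^2(cs+c-1)^2+N_0(s)^2$ for all $s\in\mathbb{R}$, and $q$ is a polynomial in $(x,y)$.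
   Context: Let $t,h,f,p\in\mathbb{R}[x,y]$ be the polynomials $$t=xy-1,\qquad h=xt^2+t,\qquad f=(xt+1)^2(t^2+y),\qquad p=f+h.$$ As polynomials, $h^3+h^2=f\,(h-t)$, so that $f=\frac{h^3+h^2}{h-t}$. The expression $\frac{h^3+h^2}{f}$ denotes the polynomial $h-t$ (also at points where $f=0$); accordingly $f^{-2}M_{-2}(h)$ denotes $-(h-t)^2$ and $f^{-1}M_{-1}(h)$ denotes $2(h-t)\big((3-c)(h^2+h)-N_0(h)\big)$. For a real function $M$ of one variable, $M(h)$ denotes the composition $(x,y)\mapsto M(h(x,y))$. For functions $a,b$ on $\mathbb{R}^2$, $J(a,b)=\frac{\partial a}{\partial x}\frac{\partial b}{\partial y}-\frac{\partial a}{\partial y}\frac{\partial b}{\partial x}$ is the Jacobian determinant of $(a,b)$. *)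

(* Defs.v *)
(* Real analysis is done over Stdlib's R with Coquelicot; the polynomial rings
   R[s] and R[x,y] are MathComp's {poly R} and {poly {poly R}}, through the ring
   structure that Rstruct puts on R. *)
From mathcomp Require Import ssreflect ssralg poly Rstruct.
From Stdlib Require Import Reals Lra.
From Coquelicot Require Import Coquelicot.

Open Scope R_scope.

Definition pt (x y : R) : R := x * y - 1.
Definition ph (x y : R) : R := x * pt x y ^ 2 + pt x y.
Definition pf (x y : R) : R := (x * pt x y + 1) ^ 2 * (pt x y ^ 2 + y).
Definition pp (x y : R) : R := pf x y + ph x y.

(* The polynomial denoted (h^3 + h^2) / f, also where f vanishes. *)
Definition h3h2_over_f (x y : R) : R := ph x y - pt x y.

Lemma h3h2_over_fE (x y : R) :
  ph x y ^ 3 + ph x y ^ 2 = pf x y * h3h2_over_f x y.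
Proof. rewrite /h3h2_over_f /pf /ph /pt; ring. Qed.

Definition dx (a : R -> R -> R) (x y : R) : R := Derive (fun u => a u y) x.
Definition dy (a : R -> R -> R) (x y : R) : R := Derive (fun v => a x v) y.

Definition has_partials (a : R -> R -> R) (x y : R) : Prop :=
  ex_derive (fun u => a u y) x /\ ex_derive (fun v => a x v) y.

Definition J (a b : R -> R -> R) (x y : R) : R :=
  dx a x y * dy b x y - dy a x y * dx b x y.

Definition differentiable_fun (g : R -> R) : Prop := forall s : R, ex_derive g s.

Definition Mm2 (s : R) : R := - (s ^ 3 + s ^ 2) ^ 2.

Definition Mm1 (c : R) (N0 : R -> R) (s : R) : R :=
  2 * (s ^ 3 + s ^ 2) * ((3 - c) * (s ^ 2 + s) - N0 s).

Definition is_N1 (c : R) (N0 N1 : R -> R) : Prop :=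
  differentiable_fun N1 /\
  forall s : R,
    - 2 * (s ^ 3 + s ^ 2) * N1 s =
    Derive (Mm1 c N0) s + s ^ 2 * (c * s + c - 1) ^ 2 + N0 s ^ 2.

Definition M1 (N1 : R -> R) (s : R) : R := - RInt (fun u => N1 u ^ 2) 0 s - s.

Definition M0 (N0 N1 : R -> R) (s : R) : R :=
  RInt (fun u => M1 N1 u - 2 * N0 u * N1 u) 0 s.

(* f^-2 M_{-2}(h) and f^-1 M_{-1}(h), extended to the zeros of f by cancelling
   f against h^3 + h^2 = f (h - t). *)
Definition fm2_Mm2 (x y : R) : R := - h3h2_over_f x y ^ 2.

Definition fm1_Mm1 (c : R) (N0 : R -> R) (x y : R) : R :=
  2 * h3h2_over_f x y * ((3 - c) * (ph x y ^ 2 + ph x y) - N0 (ph x y)).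

Lemma fm2_Mm2E (x y : R) :
  pf x y <> 0 -> fm2_Mm2 x y = / pf x y ^ 2 * Mm2 (ph x y).
Proof. by move=> f0; rewrite /fm2_Mm2 /Mm2 h3h2_over_fE; field. Qed.

Lemma fm1_Mm1E (c : R) (N0 : R -> R) (x y : R) :
  pf x y <> 0 -> fm1_Mm1 c N0 x y = / pf x y * Mm1 c N0 (ph x y).
Proof. by move=> f0; rewrite /fm1_Mm1 /Mm1 h3h2_over_fE; field. Qed.

Definition q (c : R) (N0 N1 : R -> R) (x y : R) : R :=
  fm2_Mm2 x y + fm1_Mm1 c N0 x y
  + M0 N0 N1 (ph x y) + pf x y * M1 N1 (ph x y).

(* The inner variable of {poly {poly R}} is x and the outer one is y. *)
Definition is_polynomial2 (a : R -> R -> R) : Prop :=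
  exists Q : {poly {poly R}}, forall x y : R, a x y = horner (horner Q (polyC y)) x.

(* Main.v *)
Require Import Defs.
From mathcomp Require Import ssreflect ssrfun ssrbool eqtype ssrnat seq.
From mathcomp Require Import ssralg ssrnum poly Rstruct.
From Stdlib Require Import Reals Lra.
From Coquelicot Require Import Coquelicot.
Delimit Scope ring_scope with ring.
Open Scope R_scope.

(** Put g = h - t, so that f g = h^3 + h^2. As a function on the plane, q is a
    polynomial expression in g, f, N0(h), M0(h), M1(h) and h, and J(p, .) is a
    derivation, so J(p, q) is determined by three polynomial identities:
      J(p, h) = - f,   J(p, f) = f,   J(p, g) = - (g + 3 h^2 + 2 h)
    (J_pp_ph, J_pp_pf, J_pp_h3h2_over_f). In the chain rule J_q,
      - the terms in M1(h) from f M1(h) and M0(h) cancel, as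
        M0' = M1 - 2 N0 N1 and J(p, f) = - J(p, h);
      - the equation M1' = - N1^2 - 1 produces (N1 f)^2 + f^2;
      - the term - 2 N0 N1 of M0' produces the cross term 2 N0 N1 f;
      - the cross term 2 g N1 f equals 2 (h^3 + h^2) N1, which the equation
        defining N1 expresses through N0, N0' and h.
    What remains is an identity of polynomials in g, f, h, c and the values at
    h of N0, N0' and N1 (J_pp_q). Since f never has to be inverted, the zeros
    of f need no separate treatment.

    When N0 = - s + (s^2 + s) K, the right-hand side of the equation for N1 is
    divisible by 2 s^2 (s + 1): N0 is divisible by s, hence M_{-1} by s^3 and
    its derivative by s^2, while at s = -1 the value N0(-1) = 1 makes the three
    summands - 2, 1 and 1. The quotient N1_of is a polynomial solution, and it
    is the only continuous one because the equation determines N1 off 0 and -1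
    (is_N1_unique). Hence N1, M1 and M0 are polynomials, and so is q. *)

(** * Derivatives of M1, M0 and q *)

Lemma is_derive_RInt_0 (a : R -> R) (s : R) :
  (forall u, continuous a u) -> is_derive (RInt a 0) s (a s).
Proof.
move=> ca; apply: (is_derive_RInt a (RInt a 0) 0 s); last exact: ca.
apply: filter_forall => v; apply: RInt_correct.
by apply: ex_RInt_continuous => z _; exact: ca.
Qed.

Lemma differentiable_continuous (a : R -> R) :
  differentiable_fun a -> forall u, continuous a u.
Proof. by move=> da u; apply: ex_derive_continuous; exact: da. Qed.

Lemma is_derive_M1 (N1 : R -> R) (s : R) :
  differentiable_fun N1 -> is_derive (M1 N1) s (- N1 s ^ 2 - 1).
Proof.
move=> dN1; rewrite /M1.
have dI : is_derive (RInt (fun u => N1 u ^ 2) 0) s (N1 s ^ 2).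
  apply: is_derive_RInt_0 => u; apply: ex_derive_continuous.
  by auto_derive; exact: dN1.
exact: (is_derive_minus (fun v => - RInt (fun u => N1 u ^ 2) 0 v) (fun v => v)
  s _ _ (is_derive_opp _ _ _ dI) (is_derive_id s)).
Qed.

Lemma is_derive_M0 (N0 N1 : R -> R) (s : R) :
  differentiable_fun N0 -> differentiable_fun N1 ->
  is_derive (M0 N0 N1) s (M1 N1 s - 2 * N0 s * N1 s).
Proof.
move=> dN0 dN1; apply: (is_derive_RInt_0 (fun u => M1 N1 u - 2 * N0 u * N1 u)).
apply: differentiable_continuous => u; auto_derive; repeat split => //.
by eexists; apply: is_derive_M1.
Qed.

(** This is the chain rule along one curve in the plane, with g, f and h the
    restrictions of the three functions to it; horizontal and vertical lines
    give the two partial derivatives of q. *)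
Lemma is_derive_q_along (c : R) (N0 N1 g f h : R -> R) (g' f' h' u : R) :
  differentiable_fun N0 -> differentiable_fun N1 ->
  is_derive g u g' -> is_derive f u f' -> is_derive h u h' ->
  is_derive
    (fun v => - g v ^ 2 + 2 * g v * ((3 - c) * (h v ^ 2 + h v) - N0 (h v))
              + M0 N0 N1 (h v) + f v * M1 N1 (h v)) u
    (2 * ((3 - c) * (h u ^ 2 + h u) - N0 (h u) - g u) * g'
     + M1 N1 (h u) * f'
     + (2 * g u * ((3 - c) * (2 * h u + 1) - Derive N0 (h u))
        + (M1 N1 (h u) - 2 * N0 (h u) * N1 (h u))
        + f u * (- N1 (h u) ^ 2 - 1)) * h').
Proof.
move=> dN0 dN1 dg df dh.
have dM0 := is_derive_M0 N0 N1 (h u) dN0 dN1.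
have dM1 := is_derive_M1 N1 (h u) dN1.
auto_derive.
  by repeat split; try (by eexists; eassumption); exact: dN0.
rewrite (is_derive_unique _ _ _ dg) (is_derive_unique _ _ _ df).
rewrite (is_derive_unique _ _ _ dh) (is_derive_unique _ _ _ dM0).
rewrite (is_derive_unique _ _ _ dM1).
(* Derive N0 occurs both plain and eta-expanded, as two distinct atoms. *)
by change (fun x => N0 x) with N0; ring.
Qed.

Lemma is_derive_x_pf (x y : R) : is_derive (fun u => pf u y) x (dx pf x y).
Proof. by apply: Derive_correct; rewrite /pf /pt; auto_derive. Qed.

Lemma is_derive_y_pf (x y : R) : is_derive (fun v => pf x v) y (dy pf x y).
Proof. by apply: Derive_correct; rewrite /pf /pt; auto_derive. Qed.

Lemma is_derive_x_ph (x y : R) : is_derive (fun u => ph u y) x (dx ph x y).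
Proof. by apply: Derive_correct; rewrite /ph /pt; auto_derive. Qed.

Lemma is_derive_y_ph (x y : R) : is_derive (fun v => ph x v) y (dy ph x y).
Proof. by apply: Derive_correct; rewrite /ph /pt; auto_derive. Qed.

Lemma is_derive_x_h3h2_over_f (x y : R) :
  is_derive (fun u => h3h2_over_f u y) x (dx h3h2_over_f x y).
Proof. by apply: Derive_correct; rewrite /h3h2_over_f /ph /pt; auto_derive. Qed.

Lemma is_derive_y_h3h2_over_f (x y : R) :
  is_derive (fun v => h3h2_over_f x v) y (dy h3h2_over_f x y).
Proof. by apply: Derive_correct; rewrite /h3h2_over_f /ph /pt; auto_derive. Qed.

Lemma q_has_partials (c : R) (N0 N1 : R -> R) (x y : R) :
  differentiable_fun N0 -> differentiable_fun N1 ->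
  has_partials (q c N0 N1) x y.
Proof.
move=> dN0 dN1; split; eexists.
- exact: (is_derive_q_along c N0 N1 _ _ _ _ _ _ x dN0 dN1
    (is_derive_x_h3h2_over_f x y) (is_derive_x_pf x y) (is_derive_x_ph x y)).
- exact: (is_derive_q_along c N0 N1 _ _ _ _ _ _ y dN0 dN1
    (is_derive_y_h3h2_over_f x y) (is_derive_y_pf x y) (is_derive_y_ph x y)).
Qed.

(** The chain rule J(a, q) = q_g J(a, g) + q_f J(a, f) + q_h J(a, h). The
    terms in M1' and M0' appear with the integrals already differentiated. *)
Lemma J_q (c : R) (N0 N1 : R -> R) (a : R -> R -> R) (x y : R) :
  differentiable_fun N0 -> differentiable_fun N1 ->
  let g := h3h2_over_f x y in let f := pf x y in let h := ph x y in
  J a (q c N0 N1) x y =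
    2 * ((3 - c) * (h ^ 2 + h) - N0 h - g) * J a h3h2_over_f x y
    + M1 N1 h * J a pf x y
    + (2 * g * ((3 - c) * (2 * h + 1) - Derive N0 h)
       + (M1 N1 h - 2 * N0 h * N1 h) + f * (- N1 h ^ 2 - 1)) * J a ph x y.
Proof.
move=> dN0 dN1 g f h; rewrite /J.
have -> : dx (q c N0 N1) x y = _ := is_derive_unique _ _ _
  (is_derive_q_along c N0 N1 _ _ _ _ _ _ x dN0 dN1
    (is_derive_x_h3h2_over_f x y) (is_derive_x_pf x y) (is_derive_x_ph x y)).
have -> : dy (q c N0 N1) x y = _ := is_derive_unique _ _ _
  (is_derive_q_along c N0 N1 _ _ _ _ _ _ y dN0 dN1
    (is_derive_y_h3h2_over_f x y) (is_derive_y_pf x y) (is_derive_y_ph x y)).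
by rewrite -/g -/f -/h; ring.
Qed.

(** * The Jacobians of p with f, h and g *)

Ltac derive_polynomial :=
  apply: is_derive_unique; rewrite /pp /h3h2_over_f /pf /ph /pt;
  auto_derive => //; rewrite /pt; ring.

Lemma dx_ph (x y : R) : dx ph x y = pt x y ^ 2 + 2 * x * y * pt x y + y.
Proof. derive_polynomial. Qed.

Lemma dy_ph (x y : R) : dy ph x y = 2 * x ^ 2 * pt x y + x.
Proof. derive_polynomial. Qed.

Lemma dx_pf (x y : R) : dx pf x y =
  2 * (x * pt x y + 1) * (pt x y + x * y) * (pt x y ^ 2 + y)
  + (x * pt x y + 1) ^ 2 * (2 * y * pt x y).
Proof. derive_polynomial. Qed.

Lemma dy_pf (x y : R) : dy pf x y =
  2 * (x * pt x y + 1) * x ^ 2 * (pt x y ^ 2 + y)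
  + (x * pt x y + 1) ^ 2 * (2 * x * pt x y + 1).
Proof. derive_polynomial. Qed.

Lemma dx_h3h2_over_f (x y : R) : dx h3h2_over_f x y = dx ph x y - y.
Proof. rewrite dx_ph; derive_polynomial. Qed.

Lemma dy_h3h2_over_f (x y : R) : dy h3h2_over_f x y = dy ph x y - x.
Proof. rewrite dy_ph; derive_polynomial. Qed.

Lemma dx_pp (x y : R) : dx pp x y = dx pf x y + dx ph x y.
Proof. rewrite dx_pf dx_ph; derive_polynomial. Qed.

Lemma dy_pp (x y : R) : dy pp x y = dy pf x y + dy ph x y.
Proof. rewrite dy_pf dy_ph; derive_polynomial. Qed.

Lemma J_pp_ph (x y : R) : J pp ph x y = - pf x y.
Proof. by rewrite /J dx_pp dy_pp dx_pf dy_pf dx_ph dy_ph /pf /pt; ring. Qed.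

Lemma J_pp_pf (x y : R) : J pp pf x y = pf x y.
Proof. by rewrite /J dx_pp dy_pp dx_pf dy_pf dx_ph dy_ph /pf /pt; ring. Qed.

Lemma J_pp_h3h2_over_f (x y : R) :
  J pp h3h2_over_f x y = - (h3h2_over_f x y + 3 * ph x y ^ 2 + 2 * ph x y).
Proof.
rewrite /J dx_pp dy_pp dx_h3h2_over_f dy_h3h2_over_f dx_pf dy_pf dx_ph dy_ph.
by rewrite /h3h2_over_f /ph /pt; ring.
Qed.

(** * The Jacobian of p and q *)

Lemma Derive_Mm1 (c : R) (N0 : R -> R) (s : R) :
  ex_derive N0 s ->
  Derive (Mm1 c N0) s =
    2 * (3 * s ^ 2 + 2 * s) * ((3 - c) * (s ^ 2 + s) - N0 s)
    + 2 * (s ^ 3 + s ^ 2) * ((3 - c) * (2 * s + 1) - Derive N0 s).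
Proof.
move=> dN0; apply: is_derive_unique; rewrite /Mm1; auto_derive => //.
by change (fun x => N0 x) with N0; ring.
Qed.

Lemma J_pp_q (c : R) (N0 N1 : R -> R) (x y : R) :
  differentiable_fun N0 -> is_N1 c N0 N1 ->
  J pp (q c N0 N1) x y =
    (h3h2_over_f x y - ph x y + c * (ph x y ^ 2 + ph x y)) ^ 2
    + (h3h2_over_f x y + N0 (ph x y) + N1 (ph x y) * pf x y) ^ 2
    + pf x y ^ 2.
Proof.
move=> dN0 [dN1 defN1].
rewrite J_q // J_pp_h3h2_over_f J_pp_pf J_pp_ph.
have := defN1 (ph x y); rewrite Derive_Mm1; last exact: dN0.
have := h3h2_over_fE x y.
move: (ph x y) (pf x y) (h3h2_over_f x y) => h f g hfg.
move: (N0 h) (N1 h) (Derive N0 h) (M1 N1 h) => n0 n1 n0' m1 eqN1.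
(* Trading h^3 + h^2 for f g, which is the form taken by the derivatives of q,
   makes the goal differ from this equation by an identity of polynomials. *)
have {}eqN1 : - 2 * (f * g) * n1 =
    2 * (3 * h ^ 2 + 2 * h) * ((3 - c) * (h ^ 2 + h) - n0)
    + 2 * (f * g) * ((3 - c) * (2 * h + 1) - n0')
    + h ^ 2 * (c * h + c - 1) ^ 2 + n0 ^ 2 by rewrite -hfg.
clear -eqN1; lra.
Qed.

(** * Polynomial functions of one and two variables *)

Lemma is_derive_horner (P : {poly R}) (s : R) :
  is_derive (horner P) s (horner (deriv P) s).
Proof.
elim/poly_ind: P => [|P a IH].
  rewrite deriv0 horner0; apply: (is_derive_ext (fun=> 0)) => [u|].
    by rewrite horner0.
  exact: is_derive_const.
apply: (is_derive_ext (fun u => horner P u * u + a)) => [u|].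
  by rewrite hornerMXaddC.
auto_derive; first by eexists; exact: IH.
rewrite (is_derive_unique _ _ _ IH) derivMXaddC hornerD hornerMX.
by rewrite -RplusE -RmultE; ring.
Qed.

Lemma poly_antiderivative (P : {poly R}) : exists Q : {poly R}, deriv Q = P.
Proof.
exists (\poly_(i < (size P).+1) (P`_i.-1 / i%:R))%ring.
(* The index 0 gets the coefficient P`_0 / 0, which the derivative discards. *)
apply/polyP => i; rewrite coef_deriv coef_poly ltnS.
case: ltnP => [lt_i_P|le_P_i]; last by rewrite GRing.mul0rn nth_default.
by rewrite -[LHS]GRing.mulr_natr GRing.divfK // Num.Theory.pnatr_eq0.
Qed.

Definition is_polynomial1 (a : R -> R) : Prop :=
  exists P : {poly R}, forall s, a s = horner P s.

Lemma is_polynomial1_ext (a b : R -> R) :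
  (forall s, a s = b s) -> is_polynomial1 a -> is_polynomial1 b.
Proof. by move=> eab [P aP]; exists P => s; rewrite -eab aP. Qed.

Lemma is_polynomial1_horner (P : {poly R}) :
  is_polynomial1 (fun s => horner P s).
Proof. by exists P. Qed.

Lemma is_polynomial1_const (a : R) : is_polynomial1 (fun=> a).
Proof. by exists (polyC a) => s; rewrite hornerC. Qed.

Lemma is_polynomial1_id : is_polynomial1 (fun s => s).
Proof. by exists (polyX _) => s; rewrite hornerX. Qed.

Lemma is_polynomial1_add (a b : R -> R) :
  is_polynomial1 a -> is_polynomial1 b -> is_polynomial1 (fun s => a s + b s).
Proof.
by move=> [P aP] [Q bQ]; exists (P + Q)%ring => s; rewrite hornerD aP bQ.
Qed.

Lemma is_polynomial1_opp (a : R -> R) :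
  is_polynomial1 a -> is_polynomial1 (fun s => - a s).
Proof. by move=> [P aP]; exists (- P)%ring => s; rewrite hornerN aP. Qed.

Lemma is_polynomial1_mul (a b : R -> R) :
  is_polynomial1 a -> is_polynomial1 b -> is_polynomial1 (fun s => a s * b s).
Proof.
by move=> [P aP] [Q bQ]; exists (P * Q)%ring => s; rewrite hornerM aP bQ.
Qed.

Lemma is_polynomial1_pow (a : R -> R) (n : nat) :
  is_polynomial1 a -> is_polynomial1 (fun s => a s ^ n).
Proof.
move=> a_poly; elim: n => [|n IH]; first exact: is_polynomial1_const.
exact: is_polynomial1_mul.
Qed.

Lemma is_polynomial1_RInt (a : R -> R) :
  is_polynomial1 a -> is_polynomial1 (fun s => RInt a 0 s).
Proof.
case=> P aP; have [Q QP] := poly_antiderivative P.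
exists (Q - polyC (horner Q 0))%ring => s.
rewrite hornerD hornerN hornerC; apply: is_RInt_unique.
apply: (is_RInt_ext (horner P)) => [u _|]; first by rewrite aP.
apply: (is_RInt_derive (horner Q) (horner P)) => u _.
  by rewrite -QP; exact: is_derive_horner.
by apply: ex_derive_continuous; eexists; exact: is_derive_horner.
Qed.

Ltac polynomial1 := rewrite /Rminus;
  repeat first [ assumption
    | apply is_polynomial1_const | apply is_polynomial1_id
    | apply is_polynomial1_horner | apply is_polynomial1_add
    | apply is_polynomial1_opp | apply is_polynomial1_mul
    | apply is_polynomial1_pow | apply is_polynomial1_RInt ].

Lemma is_polynomial2_ext (a b : R -> R -> R) :
  (forall x y, a x y = b x y) -> is_polynomial2 a -> is_polynomial2 b.
Proof. by move=> eab [P aP]; exists P => x y; rewrite -eab aP. Qed.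

Lemma is_polynomial2_const (a : R) : is_polynomial2 (fun _ _ => a).
Proof. by exists (polyC (polyC a)) => x y; rewrite !hornerC. Qed.

Lemma is_polynomial2_x : is_polynomial2 (fun x _ => x).
Proof. by exists (polyC (polyX _)) => x y; rewrite hornerC hornerX. Qed.

Lemma is_polynomial2_y : is_polynomial2 (fun _ y => y).
Proof. by exists (polyX _) => x y; rewrite hornerX hornerC. Qed.

Lemma is_polynomial2_add (a b : R -> R -> R) :
  is_polynomial2 a -> is_polynomial2 b ->
  is_polynomial2 (fun x y => a x y + b x y).
Proof.
by move=> [P aP] [Q bQ]; exists (P + Q)%ring => x y; rewrite !hornerD aP bQ.
Qed.

Lemma is_polynomial2_opp (a : R -> R -> R) :
  is_polynomial2 a -> is_polynomial2 (fun x y => - a x y).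
Proof. by move=> [P aP]; exists (- P)%ring => x y; rewrite !hornerN aP. Qed.

Lemma is_polynomial2_mul (a b : R -> R -> R) :
  is_polynomial2 a -> is_polynomial2 b ->
  is_polynomial2 (fun x y => a x y * b x y).
Proof.
by move=> [P aP] [Q bQ]; exists (P * Q)%ring => x y; rewrite !hornerM aP bQ.
Qed.

Lemma is_polynomial2_pow (a : R -> R -> R) (n : nat) :
  is_polynomial2 a -> is_polynomial2 (fun x y => a x y ^ n).
Proof.
move=> a_poly; elim: n => [|n IH]; first exact: is_polynomial2_const.
exact: is_polynomial2_mul.
Qed.

Ltac polynomial2 := rewrite /Rminus;
  repeat first [ assumption
    | apply is_polynomial2_const | apply is_polynomial2_x
    | apply is_polynomial2_y | apply is_polynomial2_add
    | apply is_polynomial2_opp | apply is_polynomial2_mul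
    | apply is_polynomial2_pow ].

Lemma is_polynomial2_comp (m : R -> R) (a : R -> R -> R) :
  is_polynomial1 m -> is_polynomial2 a -> is_polynomial2 (fun x y => m (a x y)).
Proof.
move=> [P mP] a_poly.
apply: (is_polynomial2_ext (fun x y => horner P (a x y))) => [x y|].
  by rewrite mP.
elim/poly_ind: P {m mP} => [|P b IH].
  apply: (is_polynomial2_ext (fun _ _ => 0)) => [x y|].
    by rewrite horner0.
  exact: is_polynomial2_const.
apply: (is_polynomial2_ext (fun x y => horner P (a x y) * a x y + b)) => [x y|].
  by rewrite hornerMXaddC.
polynomial2.
Qed.

Lemma is_polynomial2_q (c : R) (N0 N1 : R -> R) :
  is_polynomial1 N0 -> is_polynomial1 N1 -> is_polynomial2 (q c N0 N1).
Proof.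
move=> N0_poly N1_poly.
have M1_poly : is_polynomial1 (fun s => M1 N1 s) by rewrite /M1; polynomial1.
have M0_poly : is_polynomial1 (fun s => M0 N0 N1 s).
  by rewrite /M0; polynomial1.
have t_poly : is_polynomial2 (fun x y => pt x y) by rewrite /pt; polynomial2.
have h_poly : is_polynomial2 (fun x y => ph x y) by rewrite /ph; polynomial2.
have f_poly : is_polynomial2 (fun x y => pf x y) by rewrite /pf; polynomial2.
have M1h_poly := is_polynomial2_comp _ _ M1_poly h_poly.
have M0h_poly := is_polynomial2_comp _ _ M0_poly h_poly.
have N0h_poly := is_polynomial2_comp _ _ N0_poly h_poly.
by rewrite /q /fm2_Mm2 /fm1_Mm1 /h3h2_over_f; polynomial2.
Qed.

(** * Existence and uniqueness of N1 *)

(** With w = s + 1 and M_{-1} = 2 s^3 w ((3 - c) w + 1 - w K), dividing the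
    right-hand side of the equation for N1 by s^2 gives
      2 (4 w - 1) ((3 - c) w + 1 - w K) + 2 (w - 1) w (3 - c - K - w K')
      + (c w - 1)^2 + (w K - 1)^2,
    whose terms free of w cancel; the large bracket is its quotient by w. *)
Definition N1_of (c : R) (K : {poly R}) (s : R) : R :=
  let w := s + 1 in let k := horner K s in let k' := horner (deriv K) s in
  - / 2 * (2 * (4 * w - 1) * (3 - c - k) + 8
           + 2 * (w - 1) * (3 - c - k - w * k')
           + c ^ 2 * w - 2 * c + w * k ^ 2 - 2 * k).

Lemma ex_derive_horner (P : {poly R}) (s : R) : ex_derive (horner P) s.
Proof. by eexists; exact: is_derive_horner. Qed.

Lemma is_N1_N1_of (c : R) (K : {poly R}) (N0 : R -> R) :
  (forall s, N0 s = - s + (s ^ 2 + s) * horner K s) -> is_N1 c N0 (N1_of c K).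
Proof.
move=> defN0; split=> s.
  rewrite /N1_of; auto_derive.
  by repeat split; exact: ex_derive_horner.
have dN0 : is_derive N0 s
    (-1 + (2 * s + 1) * horner K s + (s ^ 2 + s) * horner (deriv K) s).
  apply: (is_derive_ext (fun u => - u + (u ^ 2 + u) * horner K u)) => [u|].
    by rewrite defN0.
  auto_derive; first exact: ex_derive_horner.
  by rewrite (is_derive_unique _ _ _ (is_derive_horner K s)); ring.
rewrite Derive_Mm1; last by eexists; exact: dN0.
rewrite (is_derive_unique _ _ _ dN0) defN0 /N1_of; field.
Qed.

Lemma is_polynomial1_N1_of (c : R) (K : {poly R}) :
  is_polynomial1 (fun s => N1_of c K s).
Proof. by rewrite /N1_of; polynomial1. Qed.

(** The equation determines N1 except at 0 and -1, the zeros of its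
    coefficient; there continuity does. *)
Lemma is_N1_unique (c : R) (N0 N1 N1' : R -> R) :
  is_N1 c N0 N1 -> is_N1 c N0 N1' -> forall s, N1 s = N1' s.
Proof.
move=> [dN1 defN1] [dN1' defN1'] s.
pose d u := N1 u - N1' u.
have d_off u : u <> 0 -> u <> -1 -> d u = 0.
  move=> u0 u1.
  have u_neq0 : -2 * (u ^ 3 + u ^ 2) <> 0.
    have -> : -2 * (u ^ 3 + u ^ 2) = -2 * u * u * (u + 1) by ring.
    by repeat apply: Rmult_integral_contrapositive_currified; lra.
  have := defN1 u; rewrite -(defN1' u) => /(Rmult_eq_reg_l _ _ _) /(_ u_neq0).
  by rewrite /d; lra.
(* d is continuous, and it vanishes on a punctured neighbourhood of s. *)
have d_lim : is_lim d s (d s).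
  apply: is_lim_continuity; apply/continuity_pt_filterlim.
  apply: (differentiable_continuous d) => u.
  exact: ex_derive_minus (dN1 u) (dN1' u).
have d_lim0 : is_lim d s 0.
  have punctured a : locally' s (fun u => u <> a).
    have [->|s_neq_a] := Req_dec s a; first by exists (mkposreal 1 Rlt_0_1).
    by apply: filter_imp (open_neq a s s_neq_a).
  apply: (is_lim_ext_loc (fun=> 0)); last exact: is_lim_const.
  apply: filter_imp (filter_and _ _ (punctured 0) (punctured (-1))).
  by move=> u [u0 u1]; rewrite d_off.
have := is_lim_unique _ _ _ d_lim; rewrite (is_lim_unique _ _ _ d_lim0).
by case; rewrite /d; lra.
Qed.

Theorem theorem2p5 (c : R) :
  (forall N0 N1 : R -> R,
     differentiable_fun N0 -> is_N1 c N0 N1 ->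
     forall x y : R,
       has_partials (q c N0 N1) x y /\
       J pp (q c N0 N1) x y =
         (h3h2_over_f x y - ph x y + c * (ph x y ^ 2 + ph x y)) ^ 2
         + (h3h2_over_f x y + N0 (ph x y) + N1 (ph x y) * pf x y) ^ 2
         + pf x y ^ 2)
  /\
  (forall (K : {poly R}) (N0 : R -> R),
     (forall s : R, N0 s = - s + (s ^ 2 + s) * horner K s) ->
     (exists N1 : R -> R, is_N1 c N0 N1) /\
     (forall N1 : R -> R, is_N1 c N0 N1 -> is_polynomial2 (q c N0 N1))).
Proof.
split=> [N0 N1 dN0 N1_ok x y|K N0 defN0].
  by split; [exact: q_has_partials dN0 N1_ok.1|exact: J_pp_q].
have N1K := is_N1_N1_of c K N0 defN0.
split=> [|N1 N1_ok]; first by exists (N1_of c K).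
apply: is_polynomial2_q.
  apply: (is_polynomial1_ext (fun s => - s + (s ^ 2 + s) * horner K s)) => [s|].
    by rewrite defN0.
  by polynomial1.
apply: is_polynomial1_ext (is_polynomial1_N1_of c K) => s.
exact: is_N1_unique N1K N1_ok s.
Qed.
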